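(* Let $n\ge3$ and let $a,b,c$ be even natural numbers. Then $$J_n\begin{pmatrix}a&0&0\\ 0&b&0\\ 0&0&c\end{pmatrix}=\sum_{k=0}^{c/2}(-1)^k\binom{c/2}{k}\frac{k!}{2^k}\sum_{r+s=k}\binom{2r}{r}\binom{2s}{s}\cdot\frac{(n-3)!!}{(c+n-3)!!}\cdot\frac{(a+b+c+n-1)!!}{(a+b+2k+n-1)!!}\cdot\frac{(n-2)!!\,(a+b+2r+n-2)!!\,(a+b+2s+n-2)!!}{(a+b+n-2)!!\,(a+2r+n-2)!!\,(b+2s+n-2)!!},$$ the inner sum running over $r,s\in\mathbb N$ with $r+s=k$. Equivalently this gives the joint moments $\int_{O_n}u_{11}^au_{22}^bu_{33}^c\,du=\frac{(n-1)!!\,a!!\,b!!\,c!!}{(a+b+c+n-1)!!}J_n(\mathrm{diag}(a,b,c))$.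
   Context: For an integer $m\ge0$, $m!!$ denotes $(m-1)(m-3)\cdots$, the product of positive integers $\le m-1$ with the parity of $m-1$ (empty product $=1$). $O_n$ is the orthogonal group with Haar probability measure; for $a\in M_{p\times q}(\mathbb N)$, $p,q\le n$, $I_n(a)=\int_{O_n}\prod_{i,j}u_{ij}^{a_{ij}}\,du$, and $J_n(a)$ is defined by $I_n(a)=\frac{(n-1)!!\prod_{i,j}a_{ij}!!}{(\sum_{i,j}a_{ij}+n-1)!!}J_n(a)$. *)

(* Defs.v *)
From HB Require Import structures.
From mathcomp Require Import all_boot all_order all_algebra.
From mathcomp Require Import all_classical all_reals all_analysis.

Set Implicit Arguments.
Unset Strict Implicit.
Unset Printing Implicit Defensive.

Import Order.TTheory GRing.Theory Num.Theory.
Import numFieldNormedType.Exports.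

Local Open Scope classical_set_scope.
Local Open Scope ring_scope.

(* The index is shifted: the largest factor is m - 1, so this is the usual
   double factorial of m - 1. *)
Definition dfact (m : nat) : nat :=
  (\prod_(1 <= k < m | odd k != odd m) k)%N.

Definition orthogonal_group {R : realType} {n : nat} : set 'M[R]_n :=
  [set u | u *m u^T = 1%:M].

Definition borel_matrix (R : realType) (n : nat) :=
  g_sigma_algebraType (@open 'M[R]_n).

(* A Borel probability measure on O_n is represented by a Borel probability
   measure on the space of all matrices that gives mass 1 to O_n. *)
Definition is_haar (R : realType) (n : nat)
    (mu : probability (borel_matrix R n) R) : Prop :=
  mu orthogonal_group = 1%E /\
  forall (g : 'M[R]_n) (A : set (borel_matrix R n)),
    orthogonal_group g -> measurable A ->
    mu [set g *m u | u in A] = mu A.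

Definition I_ (R : realType) (n p q : nat) (hp : (p <= n)%N) (hq : (q <= n)%N)
    (mu : probability (borel_matrix R n) R) (a : 'M[nat]_(p, q)) : R :=
  \int[mu]_(u in (orthogonal_group : set 'M[R]_n))
    \prod_(i < p) \prod_(j < q) u (widen_ord hp i) (widen_ord hq j) ^+ a i j.

Definition prefactor (R : realType) (n p q : nat) (a : 'M[nat]_(p, q)) : R :=
  (dfact (n - 1) * \prod_(i < p) \prod_(j < q) dfact (a i j))%N%:R /
  (dfact (\sum_(i < p) \sum_(j < q) a i j + n - 1))%N%:R.

(* J_n is defined by I_n = prefactor * J_n; the prefactor never vanishes. *)
Definition J_ (R : realType) (n p q : nat) (hp : (p <= n)%N) (hq : (q <= n)%N)
    (mu : probability (borel_matrix R n) R) (a : 'M[nat]_(p, q)) : R :=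
  I_ hp hq mu a / prefactor R n a.

Definition diag3 (a b c : nat) : 'M[nat]_3 :=
  diag_mx (\row_(i < 3) tnth [tuple a; b; c] i).

(* Main.v *)
Require Import Defs.
From HB Require Import structures.
From mathcomp Require Import all_boot all_order all_algebra.
From mathcomp Require Import all_classical all_reals all_analysis.
From mathcomp Require Import measurable_realfun.
From mathcomp Require Import ring lra zify.
Import Order.TTheory GRing.Theory Num.Theory.
Import numFieldNormedType.Exports.
Local Open Scope classical_set_scope.
Local Open Scope ring_scope.

(** Only the left invariance of [mu] is used.  Invariance under the rotation of
    rows [i] and [j], applied to a monomial in the entries and differentiated at
    angle [0], gives a linear relation between moments.  Summing it over all the
    rows [j] outside a set [S] and using the orthonormality of the columns yields
    a recursion for the moments ([row_recursion]).  With [S] the first two rows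
    [x], [y], it integrates out the third one:
      [E[x_1^a y_2^b z_3^c] = K_c E[x_1^a y_2^b (1 - x_3^2 - y_3^2)^(c/2)]],
    and after expanding the power one needs
    [F (c, d) = E[x_1^a x_3^c y_2^b y_3^d]].  Combining three of the relations gives
      [(n - 1 + b + d) F (c, d + 2) = (n - 1 + a + c) F (c + 2, d) + (d - c) F (c, d)],
    which determines [F] from [F (c, 0)]; the latter is a moment of the single
    row [x], because [y] can be integrated out.  The resulting closed form is a
    quotient of double factorials. *)

Set Implicit Arguments.
Unset Strict Implicit.
Unset Printing Implicit Defensive.

(** * Bounded measurable functions on the orthogonal group *)

Section Tame.
Context {R : realType} {n : nat}.
Notation T := (borel_matrix R n).
Notation O := (@orthogonal_group R n).

(** The bound is asked on the group only: matrix entries are unbounded on the whole space, while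
    every integral is taken over the group. Since [mu] is finite, this gives integrability. *)
Definition tame (f : T -> R) : Prop :=
  measurable_fun [set: T] f /\ exists M, forall u, O u -> `|f u| <= M.

Lemma orthogonal_group_dot (u : 'M[R]_n) (i j : 'I_n) :
  O u -> \sum_k u i k * u j k = (i == j)%:R.
Proof.
move=> /matrixP/(_ i j); rewrite !mxE => <-.
by apply: eq_bigr => k _; rewrite !mxE.
Qed.

Lemma orthogonal_group_tr (u : 'M[R]_n) : O u -> O u^T.
Proof. by rewrite /orthogonal_group/= trmxK => /mulmx1C. Qed.

Lemma orthogonal_group_coldot (u : 'M[R]_n) (k l : 'I_n) :
  O u -> \sum_i u i k * u i l = (k == l)%:R.
Proof.
move=> Ou; rewrite -(orthogonal_group_dot k l (orthogonal_group_tr Ou)).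
by apply: eq_bigr => i _; rewrite !mxE.
Qed.

Lemma measurable_entry (i j : 'I_n) :
  measurable_fun [set: T] (fun u : T => (u : 'M[R]_n) i j).
Proof.
apply: (measurability _ (RGenOpens.measurableE R)) => //.
move=> _ [_ [a [b ->]] <-]; rewrite setTI.
apply: sub_sigma_algebra.
have oI : open (`]a, b[%classic : set R) by exact: interval_open.
apply: open_comp oI.
by move=> x _; apply: coord_continuous.
Qed.

Lemma tame_cst (x : R) : tame (fun=> x).
Proof. by split; [exact: measurable_cst|exists `|x|]. Qed.

(** The rows of an orthogonal matrix are unit vectors, so the bound is 1. *)
Lemma tame_entry (i j : 'I_n) : tame (fun u : 'M[R]_n => u i j).
Proof.
split; first exact: measurable_entry.
exists 1 => u Ou; rewrite -[leRHS](sqrtr1) -sqrtr_sqr ler_sqrt//.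
have := orthogonal_group_dot i i Ou; rewrite eqxx mulr1n => <-.
rewrite (bigD1 j)//= expr2 lerDl sumr_ge0// => k _.
by rewrite -expr2 sqr_ge0.
Qed.

Lemma tameD f g : tame f -> tame g -> tame (fun u => f u + g u).
Proof.
move=> [mf [M hM]] [mg [N hN]]; split; first exact: measurable_funD.
by exists (M + N) => u Ou; rewrite (le_trans (ler_normD _ _))// lerD ?hM ?hN.
Qed.

Lemma tameM f g : tame f -> tame g -> tame (fun u => f u * g u).
Proof.
move=> [mf [M hM]] [mg [N hN]]; split; first exact: measurable_funM.
by exists (M * N) => u Ou; rewrite normrM ler_pM ?hM ?hN.
Qed.

Lemma tameN f : tame f -> tame (fun u => - f u).
Proof.
move=> tf; have := tameM (tame_cst (-1)) tf.
by congr tame; apply/funext => u; rewrite mulN1r.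
Qed.

Lemma tameX f k : tame f -> tame (fun u => f u ^+ k).
Proof.
move=> tf; elim: k => [|k ih]; first exact: tame_cst.
have := tameM tf ih.
by congr tame; apply/funext => u; rewrite exprS.
Qed.

Lemma tame_sum (I : Type) (r : seq I) (P : pred I) (f : I -> T -> R) :
  (forall i, tame (f i)) -> tame (fun u => \sum_(i <- r | P i) f i u).
Proof.
move=> tf; elim: r => [|i r ih].
  have := tame_cst 0.
  by congr tame; apply/funext => u; rewrite big_nil.
case: (boolP (P i)) => Pi.
  have := tameD (tf i) ih.
  by congr tame; apply/funext => u; rewrite big_cons Pi.
by move: ih; congr tame; apply/funext => u; rewrite big_cons (negbTE Pi).
Qed.

Lemma tame_prod (I : Type) (r : seq I) (P : pred I) (f : I -> T -> R) :
  (forall i, tame (f i)) -> tame (fun u => \prod_(i <- r | P i) f i u).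
Proof.
move=> tf; elim: r => [|i r ih].
  have := tame_cst 1.
  by congr tame; apply/funext => u; rewrite big_nil.
case: (boolP (P i)) => Pi.
  have := tameM (tf i) ih.
  by congr tame; apply/funext => u; rewrite big_cons Pi.
by move: ih; congr tame; apply/funext => u; rewrite big_cons (negbTE Pi).
Qed.

Lemma measurable_orthogonal_group : measurable (O : set T).
Proof.
(* The group is cut out by finitely many equations on the measurable dot products of rows. *)
have -> : O = \bigcap_(ij : 'I_n * 'I_n)
    ((fun u : T => \sum_k (u : 'M[R]_n) ij.1 k * (u : 'M[R]_n) ij.2 k) @^-1`
     [set (ij.1 == ij.2)%:R]).
  apply/seteqP; split => u.
    by move=> Ou [i j] _ /=; exact: orthogonal_group_dot.
  move=> h; apply/matrixP => i j; have /= hij := h (i, j) I.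
  by rewrite !mxE -hij; apply: eq_bigr => k _; rewrite mxE.
apply: fin_bigcap_measurable; first exact: finite_finset.
move=> [i j] _ /=; rewrite -[X in measurable X]setTI.
have [|m _] := @tame_sum _ (index_enum 'I_n) predT
  (fun k (u : 'M[R]_n) => u i k * u j k).
  by move=> k; apply: tameM; exact: tame_entry.
exact: m.
Qed.

(** Left multiplication is continuous: each entry of the product is a finite linear combination of
    coordinates, and neighbourhoods of a matrix are tested entry by entry. *)
Lemma measurable_mulmxl (g : 'M[R]_n) :
  measurable_fun [set: T] (fun u : T => (g *m (u : 'M[R]_n)) : T).
Proof.
apply: (@measurability _ _ T T setT _ (@open 'M[R]_n)) => //.
move=> _ [A oA <-]; rewrite setTI; apply: sub_sigma_algebra.
apply: open_comp => // u _ B [C nC sC].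
apply: (filterS (F := nbhs u)
  (P := [set v | forall i j, C i j ((g *m v) i j)])).
  by move=> v; exact: sC.
apply: (@filter_forall _ 'I_n
  (fun i => [set v | forall j, C i j ((g *m v) i j)]) (nbhs u)) => i.
apply: (@filter_forall _ 'I_n
  (fun j => [set v | C i j ((g *m v) i j)]) (nbhs u)) => j.
have c : {for u, continuous (fun v : 'M[R]_n => (g *m v) i j)}.
  have -> : (fun v : 'M[R]_n => (g *m v) i j) =
      (fun v => \sum_k g i k * v k j).
    by apply/funext => v; rewrite mxE.
  elim: (index_enum _) => [|k s ih].
    have -> : (fun v : 'M[R]_n => \sum_(k <- [::]) g i k * v k j) = fun=> 0.
      by apply/funext => v; rewrite big_nil.
    exact: cst_continuous.
  have -> : (fun v : 'M[R]_n => \sum_(l <- k :: s) g i l * v l j) =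
      (fun v => g i k * v k j) \+ (fun v => \sum_(l <- s) g i l * v l j).
    by apply/funext => v; rewrite big_cons.
  apply: continuousD; last exact: ih.
  by apply: continuousM; [exact: cst_continuous|exact: coord_continuous].
exact: c (nC i j).
Qed.

End Tame.

(** * Expectation *)

Section Expectation.
Context {R : realType} {n : nat} (mu : probability (borel_matrix R n) R).
Notation T := (borel_matrix R n).
Notation O := (@orthogonal_group R n).

Definition expect (f : T -> R) : R := \int[mu]_(u in (O : set T)) f u.

Lemma tame_integrable (f : T -> R) :
  tame f -> mu.-integrable (O : set T) (EFin \o f).
Proof.
move=> [mf [M hM]]; apply: measurable_bounded_integrable.
- exact: measurable_orthogonal_group.
- apply: le_lt_trans (ltry 1); exact: probability_le1 measurable_orthogonal_group.
- exact: measurable_funTS.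
- exists M; split; first exact: num_real.
  by move=> N MN u Ou; exact: le_trans (hM u Ou) (ltW MN).
Qed.

Lemma eq_expect (f g : T -> R) :
  (forall u, O u -> f u = g u) -> expect f = expect g.
Proof. by move=> fg; apply: eq_Rintegral => u /set_mem; exact: fg. Qed.

Lemma expectD (f g : T -> R) : tame f -> tame g ->
  expect (fun u => f u + g u) = expect f + expect g.
Proof.
by move=> tf tg; rewrite /expect RintegralD//;
  [exact: measurable_orthogonal_group|exact: tame_integrable..].
Qed.

Lemma expectZ (x : R) (f : T -> R) : tame f ->
  expect (fun u => x * f u) = x * expect f.
Proof.
by move=> tf; rewrite /expect RintegralZl//;
  [exact: measurable_orthogonal_group|exact: tame_integrable].
Qed.

Lemma expectN (f : T -> R) : tame f -> expect (fun u => - f u) = - expect f.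
Proof.
move=> tf; rewrite -mulN1r -expectZ//.
by apply: eq_expect => u _; rewrite mulN1r.
Qed.

Lemma expectB (f g : T -> R) : tame f -> tame g ->
  expect (fun u => f u - g u) = expect f - expect g.
Proof. by move=> tf tg; rewrite expectD ?expectN//; exact: tameN. Qed.

Lemma expect0 : expect (fun=> 0) = 0.
Proof.
rewrite -[RHS](mul0r (expect (fun=> 0))) -expectZ; last exact: tame_cst.
by apply: eq_expect => u _; rewrite mul0r.
Qed.

Lemma expect_sum (I : Type) (r : seq I) (P : pred I) (f : I -> T -> R) :
  (forall i, tame (f i)) ->
  expect (fun u => \sum_(i <- r | P i) f i u) = \sum_(i <- r | P i) expect (f i).
Proof.
move=> tf; elim: r => [|i r ih].
  by rewrite big_nil -[RHS]expect0; apply: eq_expect => u _; rewrite big_nil.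
rewrite big_cons -ih; case: ifPn => Pi.
  rewrite -expectD//; last exact: tame_sum.
  by apply: eq_expect => u _; rewrite big_cons Pi.
by apply: eq_expect => u _; rewrite big_cons (negbTE Pi).
Qed.

Section Haar.
Hypothesis hmu : is_haar mu.

Lemma expect1 : expect (fun=> 1) = 1.
Proof.
rewrite /expect Rintegral_cst; last exact: measurable_orthogonal_group.
have -> : (mu : {measure set T -> \bar R}) (O : set T) = 1%E by exact: hmu.1.
by rewrite mul1r.
Qed.

(** Change of variables: left multiplication by [g] maps the group onto itself and pushes [mu]
    forward to [mu]. *)
Lemma expect_mulmx (g : 'M[R]_n) (f : T -> R) : O g -> tame f ->
  expect (fun u => f (g *m u)) = expect f.
Proof.
move=> Og [mf [M hM]].
have mO := @measurable_orthogonal_group R n.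
have mg := measurable_mulmxl g.
have gg : g^T *m g = 1%:M by apply: mulmx1C.
have OgE : (fun u : T => (g *m u : T)) @^-1` (O : set T) = O.
  apply/seteqP; split => u; rewrite /orthogonal_group/= trmx_mul.
    move/mulmx1C; rewrite -mulmxA (mulmxA _ g) gg mul1mx.
    exact: mulmx1C.
  by move=> uu; rewrite -mulmxA (mulmxA u) uu mul1mx.
rewrite /expect /Rintegral; congr fine.
transitivity (\int[pushforward mu (fun u : T => (g *m u : T))]_(u in (O : set T))
    (f u)%:E)%E.
  rewrite integral_pushforward//.
  - by rewrite OgE.
  - exact/measurable_EFinP.
  - rewrite OgE; apply: (@tame_integrable (fun u => f (g *m u))); split.
      exact: measurableT_comp mf mg.
    exists M => u Ou; apply: hM; have : ((fun u : T => (g *m u : T)) @^-1` (O : set T)) u.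
      by rewrite OgE.
    by [].
apply: eq_measure_integral => A mA _ /=.
have Ogt : O g^T by exact: orthogonal_group_tr.
(* Invariance is stated for images, whereas the pushforward uses preimages: the preimage of [A]
   under [g] is its image under [g^T]. *)
rewrite /pushforward -[RHS](hmu.2 _ _ Ogt mA); congr (mu _).
apply/seteqP; split => u /=.
  by move=> Agu; exists (g *m u); rewrite // mulmxA gg mul1mx.
by move=> [v Av <-]; rewrite mulmxA Og mul1mx.
Qed.

End Haar.
End Expectation.

(** * Infinitesimal rotations *)

Section Rotation.
Context {R : realType} {n : nat}.
Notation T := (borel_matrix R n).
Notation O := (@orthogonal_group R n).

(** For [i != j], the rotation in the plane of coordinates [i] and [j], with [c] as cosine and [s]
    as sine. *)
Definition rotmx (i j : 'I_n) (c s : R) : 'M[R]_n :=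
  \matrix_(k, l) (if k == i then c * (l == i)%:R + s * (l == j)%:R
                  else if k == j then c * (l == j)%:R - s * (l == i)%:R
                  else (l == k)%:R).

Lemma sum_delta (i : 'I_n) (f : 'I_n -> R) : \sum_k (k == i)%:R * f k = f i.
Proof.
rewrite (bigD1 i)//= eqxx mul1r big1 ?addr0// => k /negbTE ->.
by rewrite mul0r.
Qed.

Lemma mul_rotmx (i j : 'I_n) (c s : R) (u : 'M[R]_n) (k l : 'I_n) :
  (rotmx i j c s *m u) k l =
  if k == i then c * u i l + s * u j l
  else if k == j then c * u j l - s * u i l else u k l.
Proof.
rewrite mxE; under eq_bigr do rewrite mxE.
case: ifP => _.
  under eq_bigr do rewrite mulrDl -!mulrA.
  by rewrite big_split/= -!mulr_sumr !sum_delta.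
case: ifP => _; last exact: sum_delta.
under eq_bigr do rewrite mulrBl -!mulrA.
by rewrite sumrB/= -!mulr_sumr !sum_delta.
Qed.

Lemma orthogonal_rotmx (i j : 'I_n) (c s : R) :
  i != j -> c ^+ 2 + s ^+ 2 = 1 -> O (rotmx i j c s).
Proof.
move=> ij cs; apply/matrixP => k l; rewrite mul_rotmx !mxE.
rewrite (eq_sym i l) (eq_sym j l) (eq_sym k l).
rewrite [j == i]eq_sym (negbTE ij) !eqxx.
have [ki|ki] := eqVneq k i; have [li|li] := eqVneq l i;
  have [kj|kj] := eqVneq k j; have [lj|lj] := eqVneq l j;
  rewrite ?(ki, li, kj, lj, eqxx, negbTE ij)/=.
all: try by rewrite -[RHS]cs; ring.
all: repeat match goal with H : is_true (?x != ?y) |- _ =>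
  rewrite ?[y == x]eq_sym ?(negbTE H)/=; clear H end.
all: by ring.
Qed.

(** Monomials are coded as lists of positions, so that the product rule becomes a statement about
    concatenation. *)
Definition word_fun (w : seq ('I_n * 'I_n)) (u : 'M[R]_n) : R :=
  \prod_(p <- w) u p.1 p.2.

(** The derivative at angle 0 of the entry at [p] under the rotation of rows [i] and [j]. *)
Definition rot_speed (i j : 'I_n) (u : 'M[R]_n) (p : 'I_n * 'I_n) : R :=
  if p.1 == i then u j p.2 else if p.1 == j then - u i p.2 else 0.

(** The variable is the tangent of the angle. Having a polynomial makes differentiation formal, so
    no derivative has to be exchanged with an integral. *)
Definition rot_poly (i j : 'I_n) (w : seq ('I_n * 'I_n)) (u : 'M[R]_n) :
    {poly R} :=
  \prod_(p <- w) ((u p.1 p.2)%:P + rot_speed i j u p *: 'X).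

Lemma tame_word_fun w : tame (word_fun w).
Proof. by apply: tame_prod => p; exact: tame_entry. Qed.

Lemma tame_rot_speed i j p : tame (fun u : 'M[R]_n => rot_speed i j u p).
Proof.
rewrite /rot_speed; case: (p.1 == i); first exact: tame_entry.
case: (p.1 == j); last exact: tame_cst.
by apply: tameN; exact: tame_entry.
Qed.

(** Adding a letter expresses coefficient [k] through coefficients [k] and [k - 1] of the shorter
    word. This allows [rot_poly] to be integrated coefficient by coefficient. *)
Lemma tame_rot_poly_coef i j w k :
  tame (fun u : 'M[R]_n => (rot_poly i j w u)`_k).
Proof.
elim: w k => [|p w ih] k.
  have := @tame_cst R n (1 : {poly R})`_k.
  by congr tame; apply/funext => u; rewrite /rot_poly big_nil.
have E u : (rot_poly i j (p :: w) u)`_k = u p.1 p.2 * (rot_poly i j w u)`_k +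
    rot_speed i j u p * (if k is k'.+1 then (rot_poly i j w u)`_k' else 0).
  rewrite /rot_poly big_cons mulrDl coefD coefCM -scalerAl coefZ coefXM.
  by case: k.
have t' : tame (fun u => if k is k'.+1 then (rot_poly i j w u)`_k' else 0).
  by case: k {E} => [|k]; [exact: tame_cst|exact: ih].
have := tameD (tameM (tame_entry p.1 p.2) (ih k))
  (tameM (tame_rot_speed i j p) t').
by congr tame; apply/funext => u; rewrite E.
Qed.

Lemma size_rot_poly i j w (u : 'M[R]_n) :
  (size (rot_poly i j w u) <= (size w).+1)%N.
Proof.
rewrite /rot_poly; elim: w => [|p w ih]; first by rewrite big_nil size_polyC oner_eq0.
rewrite big_cons (leq_trans (size_polyMleq _ _))//=.
have : (size ((u p.1 p.2)%:P + rot_speed i j u p *: 'X)%R <= 2)%N.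
  rewrite (leq_trans (size_polyD _ _))// geq_max (leq_trans (size_polyC_leq1 _))//=.
  by rewrite (leq_trans (size_scale_leq _ _))// size_polyX.
set a := size _ => a2; set b := size _ in ih *; move: ih a2; clear; case: a => [|a]; lia.
Qed.

(* The shear [u_i + b u_j, u_j - b u_i] is a rotation dilated by
   [sqrt (1 + b^2)]. *)
Lemma horner_rot_poly i j w (u : 'M[R]_n) (b : R) :
  let t := Num.sqrt (1 + b ^+ 2) in
  (rot_poly i j w u).[b] =
  t ^+ count (fun p => (p.1 == i) || (p.1 == j)) w *
  word_fun w (rotmx i j t^-1 (b / t) *m u).
Proof.
move=> t; have t0 : t != 0 by rewrite sqrtr_eq0 -ltNge; have := sqr_ge0 b; lra.
move: t t0 => t t0; rewrite /rot_poly /word_fun; elim: w => [|p w ih].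
  by rewrite !big_nil hornerC mulr1.
rewrite !big_cons hornerM ih {ih} mul_rotmx /rot_speed hornerD hornerC hornerZ hornerX.
rewrite -cat1s count_cat exprD; move: (\prod_(_ <- w) _) (count _ w) => W e.
rewrite /= addn0.
have [->|_] := eqVneq p.1 i; first by (rewrite /= expr1; field).
have [->|_] /= := eqVneq p.1 j; first by (rewrite expr1; field).
by ring.
Qed.

(** A nonzero difference would vanish at [size (p - q)] distinct naturals, more than its degree. *)
Lemma eq_poly_horner (p q : {poly R}) : (forall x, p.[x] = q.[x]) -> p = q.
Proof.
move=> pq; apply/eqP; rewrite -subr_eq0; apply/negPn/negP => /max_poly_roots.
move=> /(_ [seq i%:R | i <- iota 0 (size (p - q))]).
rewrite size_map size_iota ltnn => h; suff: false by [].
apply: h.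
  by apply/allP => x _; rewrite rootE hornerD hornerN pq subrr.
by rewrite map_inj_uniq ?iota_uniq// => a b /eqP; rewrite eqr_nat => /eqP.
Qed.

Context (mu : probability T R) (hmu : is_haar mu).

(** The factor [q] ignores the rotated rows, so by invariance the integral of [q] times the sheared
    monomial is a constant times [(1 + b^2)^(e/2)], where [e] counts the letters in rows [i] and
    [j]. This is even in [b], hence its derivative at 0 vanishes. *)
Lemma expect_rotation (i j : 'I_n) (q : T -> R) (w : seq ('I_n * 'I_n)) :
  i != j -> tame q ->
  (forall u v : 'M[R]_n,
    (forall k l, k != i -> k != j -> u k l = v k l) -> q u = q v) ->
  expect mu (fun u => q u * (rot_poly i j w u)^`().[0]) = 0.
Proof.
move=> ij tq qinv.
set e := count (fun p : 'I_n * 'I_n => (p.1 == i) || (p.1 == j)) w.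
(* One more than the size bound requires, so that the coefficient of degree 1 is present even for
   the empty word. *)
set N := (size w).+2.
pose h k u := q u * (rot_poly i j w u)`_k.
have th k : tame (h k) by apply: tameM => //; exact: tame_rot_poly_coef.
pose G : {poly R} := \poly_(k < N) expect mu (h k).
pose m := expect mu (fun u => q u * word_fun w u).
(* Invariance is applied to the rotation with cosine [1 / t] and sine [b / t]; undoing the dilation
   costs one factor [t] per rotated letter. *)
have GE b : G.[b] = Num.sqrt (1 + b ^+ 2) ^+ e * m.
  set t := Num.sqrt _; set g := rotmx i j t^-1 (b / t).
  have t0 : t != 0 by rewrite sqrtr_eq0 -ltNge; have := sqr_ge0 b; lra.
  have Og : O g.
    apply: orthogonal_rotmx => //.
    have t2 : t ^+ 2 = 1 + b ^+ 2 by rewrite sqr_sqrtr//; have := sqr_ge0 b; lra.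
    have -> : t^-1 ^+ 2 + (b / t) ^+ 2 = (1 + b ^+ 2) / t ^+ 2.
      by move: (t) t0 => t' t0'; field.
    by rewrite -t2 divff// expf_neq0.
  have twg : tame (fun u : T => q u * word_fun w u).
    by apply: tameM => //; exact: tame_word_fun.
  rewrite /m -(expect_mulmx hmu Og twg) -expectZ; last first.
    have [mq [M hM]] := twg; split.
      exact: measurableT_comp mq (measurable_mulmxl g).
    exists M => u Ou; apply: hM; rewrite /orthogonal_group/= trmx_mul.
    by rewrite -mulmxA (mulmxA u) Ou mul1mx.
  rewrite horner_poly; under eq_bigr => k _ do rewrite mulrC -(expectZ mu _ (th k)).
  rewrite -expect_sum; last first.
    by move=> k; apply: tameM; [exact: tame_cst|exact: th].
  apply: eq_expect => u _.
  have -> : q (g *m u) = q u.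
    apply: qinv => k l /negbTE ki /negbTE kj.
    by rewrite mul_rotmx ki kj.
  rewrite mulrCA -horner_rot_poly (@horner_coef_wide _ N); last first.
    exact: leq_trans (size_rot_poly _ _ _ _) _.
  by rewrite mulr_sumr; apply: eq_bigr => k _; rewrite /h; ring.
(* Squaring turns [G(b) = (1 + b^2)^(e/2) m] into an identity of polynomials,
   whatever the parity of [e]. *)
have G2 : G ^+ 2 = (1 + 'X^2) ^+ e * (m ^+ 2)%:P.
  apply: eq_poly_horner => b; rewrite !hornerE/= GE -mulrA -expr2 exprMn.
  by rewrite -exprM mulnC exprM sqr_sqrtr//; have := sqr_ge0 b; lra.
have G0 : G.[0] = m by rewrite GE expr0n addr0 sqrtr1 expr1n mul1r.
have -> : expect mu (fun u => q u * (rot_poly i j w u)^`().[0]) = G^`().[0].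
  rewrite horner_coef0 coef_deriv mulr1n coef_poly /=.
  by apply: eq_expect => u _; rewrite horner_coef0 coef_deriv mulr1n.
have [m0|m0] := eqVneq m 0.
  have /eqP : G ^+ 2 = 0 by rewrite G2 m0 expr0n mulr0.
  by rewrite sqrf_eq0 => /eqP ->; rewrite deriv0 horner0.
(* At 0 the derivative of [G ^+ 2] is [2 m G'(0)], while that of the right-hand side is 0; here [m]
   is nonzero. *)
have := congr1 (fun p => p^`().[0]) G2.
rewrite expr2 !derivM derivC deriv_exp derivD derivXn derivC !hornerE G0 /=.
rewrite hornerMn hornerM hornerMn expr1 hornerX mul0rn mul0r mul0rn !mul0r.
rewrite [m * _]mulrC -mulr2n => /eqP; rewrite mulrn_eq0/= mulf_eq0.
by rewrite (negbTE m0) orbF => /eqP.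
Qed.

End Rotation.

(** * The recursion along a row *)

Ltac tame := repeat first
  [ assumption | exact: tame_cst | exact: tame_entry | apply: tameX
  | apply: tameM | apply: tameD | apply: tameN
  | (apply: tame_sum => ?) ].

(** * Product rule for monomials along a rotation *)

Section RotationDerivative.
Context {R : realType} {n : nat}.
Implicit Type u : 'M[R]_n.

Definition rot_deriv (i j : 'I_n) (w : seq ('I_n * 'I_n)) u : R :=
  (rot_poly i j w u)^`().[0].

Lemma tame_rot_deriv i j w : tame (rot_deriv i j w).
Proof.
have := tame_rot_poly_coef (R := R) i j w 1; congr tame; apply/funext => u.
by rewrite /rot_deriv horner_coef0 coef_deriv mulr1n.
Qed.

Lemma word_fun_cat w1 w2 u : word_fun (w1 ++ w2) u = word_fun w1 u * word_fun w2 u.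
Proof. exact: big_cat. Qed.

Lemma word_fun_nseq a p u : word_fun (nseq a p) u = u p.1 p.2 ^+ a.
Proof. by rewrite /word_fun big_nseq -Monoid.iteropE. Qed.

Lemma rot_poly_at0 i j w u : (rot_poly i j w u).[0] = word_fun w u.
Proof.
rewrite horner_prod; apply: eq_bigr => p _.
by rewrite hornerD hornerC hornerZ hornerX mulr0 addr0.
Qed.

Lemma rot_deriv_cat i j w1 w2 u :
  rot_deriv i j (w1 ++ w2) u =
  rot_deriv i j w1 u * word_fun w2 u + word_fun w1 u * rot_deriv i j w2 u.
Proof.
by rewrite /rot_deriv /rot_poly big_cat/= derivM hornerD !hornerM !rot_poly_at0.
Qed.

Lemma rot_deriv_nseq i j a p u :
  rot_deriv i j (nseq a p) u = a%:R * u p.1 p.2 ^+ a.-1 * rot_speed i j u p.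
Proof.
rewrite /rot_deriv /rot_poly big_nseq -Monoid.iteropE deriv_exp hornerMn hornerM.
rewrite horner_exp derivD derivC derivZ derivX !hornerE.
by rewrite -mulr_natl; ring.
Qed.

End RotationDerivative.

Section RowRecursion.
Context {R : realType} {n : nat} (mu : probability (borel_matrix R n) R).
Hypothesis hmu : is_haar mu.
Notation T := (borel_matrix R n).
Notation O := (@orthogonal_group R n).

(** Rotate row [i] against [j] in the monomial [u_jk u_ik^a u_il^b u_im^c] and sum over all [j]
    outside [S] and [i]. Differentiating [u_jk] gives one copy of the left-hand moment for each of
    the [n - |S| - 1] rows [j]. The other letters give sums of [u_jk u_jt], which column
    orthonormality reduces to rows in [S] and row [i]; the part from row [i] supplies the remaining
    [a + b + c]. Truncated exponents such as [a.-1] are harmless, because they come with the factor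
    [a]. *)
Lemma row_recursion (i : 'I_n) (S : {set 'I_n}) (q : T -> R) (k l m : 'I_n)
    (a b c : nat) :
  i \notin S -> tame q ->
  (forall u v : 'M[R]_n, (forall s t, s \in S -> u s t = v s t) -> q u = q v) ->
  ((0 < b)%N -> k != l) -> ((0 < c)%N -> k != m) ->
  (n%:R - #|S|%:R - 1 + (a + b + c)%:R) *
    expect mu (fun u : 'M[R]_n => q u * (u i k ^+ a.+1 * u i l ^+ b * u i m ^+ c)) =
  a%:R * expect mu (fun u : 'M[R]_n => q u * (1 - \sum_(s in S) u s k ^+ 2) *
      (u i k ^+ a.-1 * u i l ^+ b * u i m ^+ c))
  - b%:R * expect mu (fun u : 'M[R]_n => q u * (\sum_(s in S) u s k * u s l) *
      (u i k ^+ a * u i l ^+ b.-1 * u i m ^+ c))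
  - c%:R * expect mu (fun u : 'M[R]_n => q u * (\sum_(s in S) u s k * u s m) *
      (u i k ^+ a * u i l ^+ b * u i m ^+ c.-1)).
Proof.
move=> iS tq qS kl km.
set L := (fun u : 'M[R]_n => q u * (u i k ^+ a.+1 * u i l ^+ b * u i m ^+ c)).
set A := (fun u : 'M[R]_n => q u * (1 - _) * _).
set B := (fun u : 'M[R]_n => _ * (_ * u i l ^+ b.-1 * _)).
set C := (fun u : 'M[R]_n => _ * (_ * u i m ^+ c.-1)).
pose w (j : 'I_n) :=
  nseq 1 (j, k) ++ nseq a (i, k) ++ nseq b (i, l) ++ nseq c (i, m).
have rw0 j : j \notin i |: S ->
    expect mu (fun u : 'M[R]_n => q u * rot_deriv i j (w j) u) = 0.
  rewrite !inE negb_or => /andP[ji jS].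
  apply: (expect_rotation hmu) => //; first by rewrite eq_sym.
  move=> u v uv; apply: qS => s t sS; apply: uv.
    by apply: contraNneq iS => <-.
  by apply: contraNneq jS => <-.
have trd j : tame (fun u => q u * rot_deriv i j (w j) u).
  by apply: tameM => //; exact: tame_rot_deriv.
have tL : tame L by rewrite /L; tame.
have tA : tame A by rewrite /A; tame.
have tB : tame B by rewrite /B; tame.
have tC : tame C by rewrite /C; tame.
have : expect mu (fun u : 'M[R]_n =>
    \sum_(j | j \notin i |: S) q u * rot_deriv i j (w j) u) = 0.
  by rewrite expect_sum// big1.
rewrite (@eq_expect _ _ _ _ (fun u => a%:R * A u - b%:R * B u - c%:R * C u -
    (n%:R - #|S|%:R - 1 + (a + b + c)%:R) * L u)).
  rewrite !expectB ?expectZ//; tame.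
  by move=> /eqP; rewrite subr_eq0 => /eqP ->.
move=> u Ou.
have sumS (f : 'I_n -> R) :
    \sum_(j | j \notin i |: S) f j = \sum_j f j - \sum_(s in S) f s - f i.
  rewrite [\sum_j f j](bigID (mem (i |: S)))/= big_setU1//=; ring.
(* Orthonormality of columns [k] and [t], with the excluded rows moved to the other side. *)
have dot (t : 'I_n) : \sum_(j | j \notin i |: S) u j k * u j t =
    (k == t)%:R - \sum_(s in S) u s k * u s t - u i k * u i t.
  by rewrite sumS orthogonal_group_coldot.
have card : \sum_(j | j \notin i |: S) (1 : R) = n%:R - #|S|%:R - 1.
  by rewrite sumS !sumr_const card_ord.
have E j : j \notin i |: S -> q u * rot_deriv i j (w j) u =
    - (L u) * 1
    + a%:R * q u * (u i k ^+ a.-1 * u i l ^+ b * u i m ^+ c) * (u j k * u j k)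
    + b%:R * q u * (u i k ^+ a * u i l ^+ b.-1 * u i m ^+ c) * (u j k * u j l)
    + c%:R * q u * (u i k ^+ a * u i l ^+ b * u i m ^+ c.-1) * (u j k * u j m).
  rewrite !inE negb_or => /andP[/negbTE ji jS].
  rewrite /w !rot_deriv_cat !rot_deriv_nseq !word_fun_cat !word_fun_nseq.
  by rewrite /rot_speed/= ji !eqxx /L [_ ^+ a.+1]exprS; ring.
(* From here the identity is algebraic; the terms with [k == l] or [k == m] vanish, either by
   distinctness or because the exponent is 0. *)
rewrite (eq_bigr _ E) !big_split/= -!mulr_sumr !dot card eqxx.
have {}kl : b%:R * (k == l)%:R = 0 :> R.
  by case: b kl {L A B C w rw0 trd tL tA tB tC E} => [|b] kl;
    rewrite ?mul0r// (negbTE (kl isT)) mulr0.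
have {}km : c%:R * (k == m)%:R = 0 :> R.
  by case: c km {L A B C w rw0 trd tL tA tB tC E} => [|c] km;
    rewrite ?mul0r// (negbTE (km isT)) mulr0.
have pX (x : R) d : d%:R * x ^+ d = d%:R * (x ^+ d.-1 * x) :> R.
  by case: d => [|d]; rewrite ?mul0r//= exprSr.
rewrite /A /B /C /L !natrD exprS.
have sqS : \sum_(s in S) u s k ^+ 2 = \sum_(s in S) u s k * u s k.
  by apply: eq_bigr => s _; rewrite expr2.
rewrite sqS.
have := pX (u i k) a; have := pX (u i l) b; have := pX (u i m) c.
move: (\sum_(s in S) _) (\sum_(s in S) _) (\sum_(s in S) _) kl km.
move: (q u) (u i k ^+ a) (u i l ^+ b) (u i m ^+ c) (u i k ^+ a.-1)
  (u i l ^+ b.-1) (u i m ^+ c.-1).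
move: (u i k) (u i l) (u i m).
move: (a%:R : R) (b%:R : R) (c%:R : R) ((k == l)%:R : R) ((k == m)%:R : R).
move: (n%:R : R) (#|S|%:R : R).
move=> n' s a' b' c' dl dm x y z q' X Y Z X' Y' Z' s1 s2 s3 hl hm hz hy hx.
have Ex : a' * X = a' * X' * x by rewrite hx mulrA.
have Ey : b' * Y = b' * Y' * y by rewrite hy mulrA.
have Ez : c' * Z = c' * Z' * z by rewrite hz mulrA.
apply/eqP; rewrite -subr_eq0; apply/eqP.
(* The difference of the two sides, written as a combination of the relations [Ex], [Ey], [Ez], [hl]
   and [hm]. *)
transitivity (q' * x * Y * Z * (a' * X - a' * X' * x)
  + q' * x * X * Z * (b' * Y - b' * Y' * y) + q' * x * X * Y * (c' * Z - c' * Z' * z)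
  + q' * X * Y' * Z * (b' * dl) + q' * X * Y * Z' * (c' * dm)).
  rewrite (_ : true%:R = 1)//; ring.
by rewrite Ex Ey Ez hl hm !subrr !mulr0 !addr0.
Qed.

End RowRecursion.

(** * Moments of one entry and of one row *)

Lemma dfactSS m : dfact m.+2 = (m.+1 * dfact m)%N.
Proof.
case: m => [|m]; first by rewrite /dfact big_mkcond big_nat1 big_geq.
rewrite /dfact !big_mkcond big_nat_recr//= [in LHS]big_nat_recr//= mulnC.
rewrite !negbK eqxx; case: (odd m) => //=; rewrite muln1; congr (_ * _)%N.
all: by rewrite [RHS]big_mkcond.
Qed.

Lemma dfact0 : dfact 0 = 1%N.
Proof. by rewrite /dfact big_geq. Qed.

Lemma dfact_gt0 m : (0 < dfact m)%N.
Proof.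
by rewrite /dfact big_nat_cond prodn_cond_gt0// => k /andP[/andP[]].
Qed.

Lemma dfact_neq0 {R : numDomainType} m : (dfact m)%:R != 0 :> R.
Proof. by rewrite pnatr_eq0 -lt0n dfact_gt0. Qed.

Ltac solve_neq0 := repeat (apply/andP; split); rewrite ?dfact_neq0 //;
  (apply: lt0r_neq0; apply: ltr_wpDr; rewrite ?addr_ge0 ?mulr_ge0 ?ler0n//).

Section Moments.
Context {R : realType}.
Local Notation df m := ((dfact m)%:R : R).

Lemma dfactSSr m : df m.+2 = m.+1%:R * df m.
Proof. by rewrite dfactSS natrM. Qed.

(** Given the rows in [S], row [i] is uniform on the unit sphere of their orthogonal complement, of
    dimension [M + 1], and [1 - \sum_(s in S) u s k ^+ 2] is the squared length of the projection of
    the [k]-th basis vector to it. The proof is an induction on [t] by [row_recursion]. *)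
Lemma entry_moment (n : nat) (mu : probability (borel_matrix R n) R)
    (i : 'I_n) (S : {set 'I_n}) (q : borel_matrix R n -> R) (k : 'I_n) (M t : nat) :
  is_haar mu -> n = (#|S| + M.+1)%N -> i \notin S -> tame q ->
  (forall u v : 'M[R]_n, (forall s l, s \in S -> u s l = v s l) -> q u = q v) ->
  expect mu (fun u : 'M[R]_n => q u * u i k ^+ t.*2) =
  df t.*2 * df M / df (t.*2 + M) *
  expect mu (fun u : 'M[R]_n => q u * (1 - \sum_(s in S) u s k ^+ 2) ^+ t).
Proof.
move=> hmu nE iS; elim: t q => [|t ih] q tq qS.
  rewrite dfact0 add0n mul1r divff ?dfact_neq0// mul1r.
  by apply: eq_expect => u _; rewrite !expr0.
(* The factor produced by one use of the recursion depends on rows in [S] only, so it is absorbed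
   into [q]. *)
pose q' (u : 'M[R]_n) := q u * (1 - \sum_(s in S) u s k ^+ 2).
have tq' : tame q' by rewrite /q'; tame.
have q'S (u v : 'M[R]_n) :
    (forall s l, s \in S -> u s l = v s l) -> q' u = q' v.
  move=> uv; rewrite /q' (qS u v)//; congr (_ * (1 - _)).
  by apply: eq_bigr => s sS; rewrite uv.
have vac (P : Prop) : (0 < 0)%N -> P by [].
have := row_recursion (k := k) (l := k) (m := k) (b := 0) (c := 0) hmu t.*2.+1
  iS tq qS (vac _) (vac _).
rewrite !mul0r !subr0 (@eq_expect _ _ mu _ (fun u : 'M[R]_n => q u * u i k ^+ t.+1.*2));
  last by move=> u _; rewrite !expr0 !mulr1.
rewrite [in RHS](@eq_expect _ _ mu _ (fun u : 'M[R]_n => q' u * u i k ^+ t.*2));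
  last by move=> u _; rewrite !expr0 !mulr1.
have tM : (t.+1.*2 + M)%N = (t.*2 + M).+2 by rewrite doubleS !addSn.
rewrite ih// tM doubleS !dfactSSr.
rewrite (@eq_expect _ _ mu (fun u : 'M[R]_n => q' u * _)
  (fun u : 'M[R]_n => q u * (1 - \sum_(s in S) u s k ^+ 2) ^+ t.+1)); last first.
  by move=> u _; rewrite /q' exprS mulrA.
have -> : n%:R - #|S|%:R - 1 + (t.*2.+1 + 0 + 0)%:R = (t.*2 + M).+1%:R :> R.
  by rewrite {1}nE !natrD -!natr1 natrD; ring.
move=> h; have d0 := dfact_neq0 (t.*2 + M).
have e0 : (t.*2 + M).+1%:R != 0 :> R by rewrite pnatr_eq0.
apply: (mulfI e0); rewrite h; move: e0 d0.
by move: ((t.*2 + M).+1%:R : R) => e e0 d0; field; rewrite d0.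
Qed.

Section OneRow.
Context {L : nat} (mu : probability (borel_matrix R L.+3) R).
Hypothesis hmu : is_haar mu.

(** The case of empty [S] and [q = 1]: both correction terms of the recursion vanish. *)
Lemma row_moment_step (i k1 k2 k3 : 'I_L.+3) (a b c : nat) :
  k1 != k2 -> k1 != k3 ->
  (a + b + c + L.+3)%:R *
    expect mu (fun u : 'M[R]_L.+3 => u i k1 ^+ a.+2 * u i k2 ^+ b * u i k3 ^+ c) =
  a.+1%:R *
    expect mu (fun u : 'M[R]_L.+3 => u i k1 ^+ a * u i k2 ^+ b * u i k3 ^+ c).
Proof.
move=> k12 k13.
have := row_recursion hmu (i := i) (S := finset.set0) (q := fun=> 1) (k := k1)
  (l := k2) (m := k3) (b := b) (c := c) a.+1.
rewrite inE => /(_ isT (tame_cst 1) (fun _ _ _ => erefl) (fun _ => k12) (fun _ => k13)).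
rewrite [X in _ * X](@eq_expect _ _ mu _
  (fun u : 'M[R]_L.+3 => u i k1 ^+ a.+2 * u i k2 ^+ b * u i k3 ^+ c)); last first.
  by move=> u _; rewrite mul1r.
rewrite [X in _ = _ * X - _ - _](@eq_expect _ _ mu _
  (fun u : 'M[R]_L.+3 => u i k1 ^+ a * u i k2 ^+ b * u i k3 ^+ c)); last first.
  by move=> u _; rewrite big_set0 subr0 !mul1r.
rewrite [X in _ = _ - _ * X - _](@eq_expect _ _ mu _ (fun=> 0)); last first.
  by move=> u _; rewrite big_set0 mulr0 mul0r.
rewrite [X in _ = _ - _ - _ * X](@eq_expect _ _ mu _ (fun=> 0)); last first.
  by move=> u _; rewrite big_set0 mulr0 mul0r.
rewrite expect0 !mulr0 !subr0 => <-; congr (_ * _).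
by rewrite cards0 !natrD -!natr1; ring.
Qed.

Lemma row_moment (i k1 k2 k3 : 'I_L.+3) (a b c : nat) :
  k1 != k2 -> k1 != k3 -> k2 != k3 ->
  expect mu (fun u : 'M[R]_L.+3 => u i k1 ^+ a.*2 * u i k2 ^+ b.*2 * u i k3 ^+ c.*2) =
  df L.+2 * (df a.*2 * df b.*2 * df c.*2) / df (a.*2 + b.*2 + c.*2 + L.+2).
Proof.
move=> k12 k13 k23.
have step (x y z : R) (m : nat) : m.+1%:R * x = z * y -> x = z * y / m.+1%:R.
  by move=> <-; rewrite mulrAC divff ?mul1r// pnatr_eq0.
elim: a => [|a iha]; last first.
  have := row_moment_step i a.*2 b.*2 c.*2 k12 k13.
  rewrite iha addnS => /step ->; rewrite doubleS !addSn !dfactSSr !addnS.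
  by field; solve_neq0.
(* The step lowers only its first column, so the columns are permuted and the exhausted ones carry
   exponent 0. *)
elim: b => [|b ihb]; last first.
  have := row_moment_step i b.*2 0 c.*2 (_ : k2 != k1) k23.
  rewrite eq_sym => /(_ k12).
  rewrite (@eq_expect _ _ mu _ (fun u : 'M[R]_L.+3 =>
    u i k1 ^+ 0.*2 * u i k2 ^+ b.+1.*2 * u i k3 ^+ c.*2)); last first.
    by move=> u _; rewrite mulr1 mul1r.
  rewrite [in RHS](@eq_expect _ _ mu _ (fun u : 'M[R]_L.+3 =>
    u i k1 ^+ 0.*2 * u i k2 ^+ b.*2 * u i k3 ^+ c.*2)); last first.
    by move=> u _; rewrite mulr1 mul1r.
  rewrite ihb addnS => /step ->; rewrite doubleS !addSn !dfactSSr !addn0 !addnS.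
  by rewrite !add0n; field; solve_neq0.
elim: c => [|c ihc]; last first.
  have := row_moment_step i c.*2 0 0 (_ : k3 != k1) (_ : k3 != k2).
  rewrite eq_sym => /(_ k13); rewrite eq_sym => /(_ k23).
  rewrite (@eq_expect _ _ mu _ (fun u : 'M[R]_L.+3 =>
    u i k1 ^+ 0.*2 * u i k2 ^+ 0.*2 * u i k3 ^+ c.+1.*2)); last first.
    by move=> u _; rewrite !mulr1 !mul1r.
  rewrite [in RHS](@eq_expect _ _ mu _ (fun u : 'M[R]_L.+3 =>
    u i k1 ^+ 0.*2 * u i k2 ^+ 0.*2 * u i k3 ^+ c.*2)); last first.
    by move=> u _; rewrite !mulr1 !mul1r.
  rewrite ihc addnS => /step ->; rewrite doubleS !addSn !dfactSSr !addn0 !addnS.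
  by rewrite !add0n; field; solve_neq0.
rewrite (@eq_expect _ _ mu _ (fun=> 1)); last by move=> u _; rewrite !mulr1.
by rewrite expect1// dfact0 !mulr1 divff// dfact_neq0.
Qed.

(** The power of [1 - x^2] is what remains on the first row once the second has been integrated out.
    Induction on [e] for all [b], splitting off one factor [1 - x^2]. *)
Lemma row_moment_compl (i k1 k2 k3 : 'I_L.+3) (a b c e : nat) :
  k1 != k2 -> k1 != k3 -> k2 != k3 ->
  expect mu (fun u : 'M[R]_L.+3 =>
    u i k1 ^+ a.*2 * u i k2 ^+ b.*2 * u i k3 ^+ c.*2 * (1 - u i k2 ^+ 2) ^+ e) =
  df L.+2 * (df a.*2 * df b.*2 * df c.*2) * df (a.*2 + c.*2 + e.*2 + L.+1) /
  (df (a.*2 + c.*2 + L.+1) * df (a.*2 + b.*2 + c.*2 + e.*2 + L.+2)).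
Proof.
move=> k12 k13 k23; elim: e b => [|e ih] b.
  rewrite (eq_expect _ (g := fun u : 'M[R]_L.+3 =>
    u i k1 ^+ a.*2 * u i k2 ^+ b.*2 * u i k3 ^+ c.*2)); last first.
    by move=> u _; rewrite mulr1.
  rewrite row_moment// !addn0; field.
  by rewrite !dfact_neq0.
rewrite (@eq_expect _ _ mu _ (fun u : 'M[R]_L.+3 =>
    u i k1 ^+ a.*2 * u i k2 ^+ b.*2 * u i k3 ^+ c.*2 * (1 - u i k2 ^+ 2) ^+ e -
    u i k1 ^+ a.*2 * u i k2 ^+ b.+1.*2 * u i k3 ^+ c.*2 *
    (1 - u i k2 ^+ 2) ^+ e)); last first.
  by move=> u _; rewrite doubleS [_ ^+ b.*2.+2]exprSr [_ ^+ b.*2.+1]exprSr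
    [_ ^+ e.+1]exprS; ring.
rewrite expectB; [|tame..].
rewrite !ih !doubleS !(addSn, addnS) !dfactSSr.
by field; solve_neq0.
Qed.

End OneRow.
End Moments.

(** * Moments of two rows *)

Section TwoRows.
Context {R : realType} {L : nat} (mu : probability (borel_matrix R L.+3) R).
Local Notation df m := ((dfact m)%:R : R).
Hypothesis hmu : is_haar mu.

Section Rows.
Variables (i j k1 k2 k3 : 'I_L.+3).
Hypotheses (ij : i != j) (k12 : k1 != k2) (k13 : k1 != k3) (k23 : k2 != k3).

(** The rows share only column [k3], with exponents [c] and [d]; [a] and [b] belong to the separate
    columns [k1] and [k2]. *)
Definition two_row_moment a b c d : R := expect mu (fun u : 'M[R]_L.+3 =>
  u i k1 ^+ a * u i k3 ^+ c * (u j k2 ^+ b * u j k3 ^+ d)).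

(* A signed sum of three relations: rotating row [j] against the rows other
   than [i], rotating row [i] against the rows other than [j], and rotating
   rows [i] and [j] against each other.  The mixed moments [P] and [Q], which
   are not of the form [two_row_moment], cancel out. *)
Lemma two_row_moment_step a b c d :
  (b + d + L.+2)%:R * two_row_moment a b c d.+2 =
  (a + c + L.+2)%:R * two_row_moment a b c.+2 d +
  (d%:R - c%:R) * two_row_moment a b c d.
Proof.
have vac (P : Prop) : (0 < 0)%N -> P by [].
(* [P] and [Q] always appear multiplied by [a] and [b], so the truncated exponents do no harm when
   these are 0. *)
pose P := expect mu (fun u : 'M[R]_L.+3 => u j k2 ^+ b * u j k3 ^+ d *
  (u j k3 * u j k1) * (u i k3 ^+ c.+1 * u i k1 ^+ a.-1)).
pose Q := expect mu (fun u : 'M[R]_L.+3 => u i k1 ^+ a * u i k3 ^+ c *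
  (u i k3 * u i k2) * (u j k3 ^+ d.+1 * u j k2 ^+ b.-1)).
have e1 : (L.+1 + (d.+1 + b))%:R * two_row_moment a b c d.+2 =
    d.+1%:R * (two_row_moment a b c d - two_row_moment a b c.+2 d) - b%:R * Q.
  have := row_recursion (i := j) (S := [set i]%SET) (k := k3) (l := k2) (m := k3)
    (q := fun u : 'M[R]_L.+3 => u i k1 ^+ a * u i k3 ^+ c) (b := b) (c := 0)
    hmu d.+1.
  rewrite inE eq_sym => /(_ ij) /=.
  have tq : tame (fun u : 'M[R]_L.+3 => u i k1 ^+ a * u i k3 ^+ c) by tame.
  move=> /(_ tq) /=.
  have qS (u v : 'M[R]_L.+3) :
      (forall s t, s \in [set i]%SET -> u s t = v s t) ->
      u i k1 ^+ a * u i k3 ^+ c = v i k1 ^+ a * v i k3 ^+ c.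
    by move=> uv; rewrite !uv// inE.
  have k32 : k3 != k2 by rewrite eq_sym.
  move=> /(_ qS (fun _ => k32) (vac _)).
  rewrite mul0r subr0 /two_row_moment -expectB; [|tame..].
  rewrite (@eq_expect _ _ mu _ (fun u : 'M[R]_L.+3 =>
    u i k1 ^+ a * u i k3 ^+ c * (u j k2 ^+ b * u j k3 ^+ d.+2))); last first.
    by move=> u _; rewrite expr0 mulr1 [u j k2 ^+ b * _]mulrC.
  rewrite [X in _ = _ * X - _](@eq_expect _ _ mu _ (fun u : 'M[R]_L.+3 =>
    u i k1 ^+ a * u i k3 ^+ c * (u j k2 ^+ b * u j k3 ^+ d) -
    u i k1 ^+ a * u i k3 ^+ c.+2 * (u j k2 ^+ b * u j k3 ^+ d))); last first.
    by move=> u _; rewrite big_set1 [_ ^+ c.+2]exprSr [_ ^+ c.+1]exprSr /=; ring.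
  rewrite [X in _ = _ - _ * X](_ : _ = Q); last first.
    by apply: eq_expect => u _; rewrite big_set1 expr0 mulr1.
  move=> <-; congr (_ * _).
  by rewrite cards1 !natrD -!natr1; ring.
have e3 : (L.+1 + (c.+1 + a))%:R * two_row_moment a b c.+2 d =
    c.+1%:R * (two_row_moment a b c d - two_row_moment a b c d.+2) - a%:R * P.
  have := row_recursion (i := i) (S := [set j]%SET) (k := k3) (l := k1) (m := k3)
    (q := fun u : 'M[R]_L.+3 => u j k2 ^+ b * u j k3 ^+ d) (b := a) (c := 0)
    hmu c.+1.
  rewrite inE => /(_ ij) /=.
  have tq : tame (fun u : 'M[R]_L.+3 => u j k2 ^+ b * u j k3 ^+ d) by tame.
  move=> /(_ tq) /=.
  have qS (u v : 'M[R]_L.+3) :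
      (forall s t, s \in [set j]%SET -> u s t = v s t) ->
      u j k2 ^+ b * u j k3 ^+ d = v j k2 ^+ b * v j k3 ^+ d.
    by move=> uv; rewrite !uv// inE.
  have k31 : k3 != k1 by rewrite eq_sym.
  move=> /(_ qS (fun _ => k31) (vac _)).
  rewrite mul0r subr0 /two_row_moment -expectB; [|tame..].
  rewrite (@eq_expect _ _ mu _ (fun u : 'M[R]_L.+3 =>
    u i k1 ^+ a * u i k3 ^+ c.+2 * (u j k2 ^+ b * u j k3 ^+ d))); last first.
    by move=> u _; rewrite expr0 mulr1 mulrC [u i k1 ^+ a * _]mulrC.
  rewrite [X in _ = _ * X - _](@eq_expect _ _ mu _ (fun u : 'M[R]_L.+3 =>
    u i k1 ^+ a * u i k3 ^+ c * (u j k2 ^+ b * u j k3 ^+ d) -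
    u i k1 ^+ a * u i k3 ^+ c * (u j k2 ^+ b * u j k3 ^+ d.+2))); last first.
    by move=> u _; rewrite big_set1 [_ ^+ d.+2]exprSr [_ ^+ d.+1]exprSr /=; ring.
  rewrite [X in _ = _ - _ * X](_ : _ = P); last first.
    by apply: eq_expect => u _; rewrite big_set1 expr0 mulr1.
  move=> <-; congr (_ * _).
  by rewrite cards1 !natrD -!natr1; ring.
have e12 : a%:R * P + c.+1%:R * two_row_moment a b c d.+2 - b%:R * Q -
    d.+1%:R * two_row_moment a b c.+2 d = 0.
  (* Column [k3] gets exponents [c + 1] and [d + 1]: moving one factor between the rows then yields
     the moments at [(c, d + 2)] and [(c + 2, d)]. *)
  have := expect_rotation hmu
    (nseq a (i, k1) ++ nseq c.+1 (i, k3) ++ nseq b (j, k2) ++ nseq d.+1 (j, k3))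
    ij (tame_cst 1) (fun _ _ _ => erefl).
  move=> <-; rewrite /P /Q /two_row_moment -!expectZ; [|tame..].
  rewrite -!(expectD, expectB); [|tame..].
  apply: eq_expect => u _; rewrite mul1r.
  rewrite -/(rot_deriv _ _ _ _) !rot_deriv_cat !rot_deriv_nseq.
  rewrite !word_fun_cat !word_fun_nseq /rot_speed/= !eqxx eq_sym (negbTE ij).
  rewrite [_ ^+ d.+2]exprSr [_ ^+ d.+1]exprSr [_ ^+ c.+2]exprSr [_ ^+ c.+1]exprSr.
  by ring.
move: e1 e3 e12; move: (two_row_moment a b c d) (two_row_moment a b c.+2 d)
  (two_row_moment a b c d.+2) => F Fc Fd e1 e3 e12.
apply/eqP; rewrite -subr_eq0; apply/eqP.
transitivity (((L.+1 + (d.+1 + b))%:R * Fd - (d.+1%:R * (F - Fc) - b%:R * Q))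
  - ((L.+1 + (c.+1 + a))%:R * Fc - (c.+1%:R * (F - Fd) - a%:R * P))
  + (a%:R * P + c.+1%:R * Fd - b%:R * Q - d.+1%:R * Fc)); first by ring.
by rewrite e1 e3 e12 !subrr addr0.
Qed.

(** Induction on [d] for all [c]. For [d = 0], row [j] has a single factor and [entry_moment]
    removes it; the step solves the linear relation for the moment with larger [d]. *)
Lemma two_row_momentE a b c d :
  two_row_moment a.*2 b.*2 c.*2 d.*2 =
  df L.+2 * df L.+1 * (df a.*2 * df b.*2 * df c.*2 * df d.*2) *
  (df (a.*2 + b.*2 + c.*2 + L.+1) * df (a.*2 + b.*2 + d.*2 + L.+1)) /
  (df (a.*2 + b.*2 + c.*2 + d.*2 + L.+2) * df (a.*2 + b.*2 + L.+1) *
   df (a.*2 + c.*2 + L.+1) * df (b.*2 + d.*2 + L.+1)).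
Proof.
elim: d c => [|d ih] c.
  rewrite /two_row_moment.
  rewrite (@eq_expect _ _ mu _ (fun u : 'M[R]_L.+3 =>
    u i k1 ^+ a.*2 * u i k3 ^+ c.*2 * u j k2 ^+ b.*2)); last first.
    by move=> u _; rewrite expr0 mulr1.
  have ji : j \notin [set i]%SET by rewrite inE eq_sym.
  have tq : tame (fun u : 'M[R]_L.+3 => u i k1 ^+ a.*2 * u i k3 ^+ c.*2) by tame.
  have := @entry_moment _ _ mu j [set i]%SET _ k2 L.+1 b hmu _ ji tq.
  rewrite cards1 => -> //; last by move=> u v uv; rewrite !uv// inE.
  rewrite (@eq_expect _ _ mu _ (fun u : 'M[R]_L.+3 =>
    u i k1 ^+ a.*2 * u i k2 ^+ 0.*2 * u i k3 ^+ c.*2 *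
    (1 - u i k2 ^+ 2) ^+ b)); last first.
    by move=> u _; rewrite big_set1 expr0 mulr1.
  rewrite (row_moment_compl hmu)// !addn0 dfact0 [(a.*2 + c.*2 + b.*2)%N]addnAC.
  by field; solve_neq0.
have := two_row_moment_step a.*2 b.*2 c.*2 d.*2.
rewrite -!doubleS !ih => h.
have e0 : (b.*2 + d.*2 + L.+2)%:R != 0 :> R by rewrite addnS pnatr_eq0.
apply: (mulfI e0); rewrite h !doubleS !(addSn, addnS) !dfactSSr.
by field; solve_neq0.
Qed.

End Rows.
End TwoRows.

(** * The diagonal moment *)

(** [dfact r.*2] collects the odd factors of [(2r)!], and the even ones give [2^r r!]. *)
Lemma fact_dfact r : (r.*2)`! = (2 ^ r * r`! * dfact r.*2)%N.
Proof.
elim: r => [|r ih]; first by rewrite dfact0.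
rewrite doubleS !factS ih dfactSS expnS.
by have -> : r.*2.+2 = (2 * r.+1)%N; [rewrite mul2n|ring].
Qed.

Lemma central_binomial_dfact r :
  ('C(r.*2, r) * r`! = 2 ^ r * dfact r.*2)%N.
Proof.
have := @bin_fact r.*2 r; rewrite -addnn leq_addr addnK addnn fact_dfact.
move=> /(_ isT) h; apply/eqP; rewrite -(eqn_pmul2r (fact_gt0 r)); apply/eqP.
by rewrite -mulnA h; lia.
Qed.

(** Turns the binomial coefficient from expanding [(x_3^2 + y_3^2)^k], with the double factorials of
    the two-row moment, into the central binomials of the final formula. *)
Lemma binomial_dfact (R : numFieldType) k r : (r <= k)%N ->
  'C(k, r)%:R * (dfact r.*2)%:R * (dfact (k - r).*2)%:R =
  k`!%:R / 2 ^+ k * ('C(r.*2, r)%:R * 'C((k - r).*2, k - r)%:R) :> R.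
Proof.
move=> rk; have f0 m : m`!%:R != 0 :> R by rewrite pnatr_eq0 -lt0n fact_gt0.
have cb m : 'C(m.*2, m)%:R = 2 ^+ m * (dfact m.*2)%:R / m`!%:R :> R.
  by apply: (mulIf (f0 m)); rewrite mulfVK// -natrM central_binomial_dfact natrM natrX.
have bk : 'C(k, r)%:R = k`!%:R / (r`!%:R * (k - r)`!%:R) :> R.
  rewrite -natrM -(bin_fact rk) natrM mulfK// natrM mulf_neq0//.
have -> : 2 ^+ k = 2 ^+ r * 2 ^+ (k - r) :> R by rewrite -exprD subnKC.
rewrite !cb bk; have e0 m : 2 ^+ m != 0 :> R by rewrite expf_neq0// pnatr_eq0.
by field; rewrite !f0 !e0.
Qed.

Lemma diag3E a b c (i j : 'I_3) :
  diag3 a b c i j = if i == j then tnth [tuple a; b; c] i else 0%N.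
Proof. by rewrite /diag3 !mxE; case: (eqVneq i j) => [->|_]; rewrite ?mulr1n. Qed.

Section Diagonal.
Context {R : realType} {L : nat} (mu : probability (borel_matrix R L.+3) R).
Hypothesis hmu : is_haar mu.
Local Notation df m := ((dfact m)%:R : R).

(** [entry_moment] over the first two rows integrates out the third; then two binomial expansions
    reduce everything to two-row moments. *)
Lemma diagonal_moment (i1 i2 i3 : 'I_L.+3) a b c :
  i1 != i2 -> i1 != i3 -> i2 != i3 ->
  expect mu (fun u : 'M[R]_L.+3 =>
    u i1 i1 ^+ a.*2 * u i2 i2 ^+ b.*2 * u i3 i3 ^+ c.*2) =
  df c.*2 * df L / df (c.*2 + L) *
  \sum_(k < c.+1) (-1) ^+ k * 'C(c, k)%:R *
    \sum_(r < k.+1) 'C(k, r)%:R *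
      two_row_moment mu i1 i2 i1 i2 i3 a.*2 b.*2 r.*2 (k - r).*2.
Proof.
move=> i12 i13 i23.
have i3S : i3 \notin [set i1; i2]%SET by rewrite !inE ![i3 == _]eq_sym negb_or i13.
have tq : tame (fun u : 'M[R]_L.+3 => u i1 i1 ^+ a.*2 * u i2 i2 ^+ b.*2) by tame.
have := @entry_moment _ _ mu i3 [set i1; i2]%SET _ i3 L c hmu _ i3S tq.
rewrite cards2 i12 => -> //; last by move=> u v uv; rewrite !uv// !inE eqxx ?orbT.
congr (_ * _).
rewrite (@eq_expect _ _ mu _ (fun u : 'M[R]_L.+3 => \sum_(k < c.+1)
   (-1) ^+ k * 'C(c, k)%:R * \sum_(r < k.+1) 'C(k, r)%:R *
   (u i1 i1 ^+ a.*2 * u i1 i3 ^+ r.*2 * (u i2 i2 ^+ b.*2 * u i2 i3 ^+ (k - r).*2)))).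
  rewrite expect_sum; last by move=> k; tame.
  apply: eq_bigr => k _; rewrite expectZ; last by tame.
  congr (_ * _); rewrite expect_sum; last by move=> r; tame.
  by apply: eq_bigr => r _; rewrite expectZ//; tame.
move=> u _; rewrite big_setU1 ?inE//= big_set1 exprBn mulr_sumr.
apply: eq_bigr => k _; rewrite expr1n mulr1 -mulr_natr.
rewrite mulrC -!mulrA; congr (_ * _); rewrite mulrCA; congr (_ * _).
(* The summands are swapped first, so that [r] is the exponent attached to row [i1]. *)
rewrite addrC exprDn mulrC mulr_sumr; apply: eq_bigr => r _.
by rewrite -mulr_natr -!exprM !mul2n; ring.
Qed.

End Diagonal.

(** * The integral and the prefactor for a diagonal exponent matrix *)

Section Diag3.
Context {R : realType} {L : nat} (mu : probability (borel_matrix R L.+3) R).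
Local Notation df m := ((dfact m)%:R : R).
Variable hn : (3 <= L.+3)%N.
Local Notation i1 := (widen_ord hn (@Ordinal 3 0 isT)).
Local Notation i2 := (widen_ord hn (@Ordinal 3 1 isT)).
Local Notation i3 := (widen_ord hn (@Ordinal 3 2 isT)).

Lemma I_diag3E a b c : I_ hn hn mu (diag3 a b c) =
  expect mu (fun u : 'M[R]_L.+3 => u i1 i1 ^+ a * u i2 i2 ^+ b * u i3 i3 ^+ c).
Proof.
apply: eq_Rintegral => u _.
rewrite !(big_ord_recl, big_ord0) !diag3E /= !expr0 !mulr1 !mul1r mulrA.
by congr (u _ _ ^+ _ * u _ _ ^+ _ * u _ _ ^+ _); apply/val_inj.
Qed.

Lemma prefactor_diag3E a b c : prefactor R L.+3 (diag3 a b c) =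
  df L.+2 * df a * df b * df c / df (a + b + c + L.+2).
Proof.
rewrite /prefactor !(big_ord_recl, big_ord0) !diag3E /=.
rewrite !dfact0 !muln1 !mul1n !addn0 !add0n !natrM !mulrA subn1 /=.
by congr (_ / (dfact _)%:R); rewrite addnA addnS subn1.
Qed.

End Diag3.

Unset Implicit Arguments.

Theorem theorem7p2 (R : realType) (n : nat) (hn : (3 <= n)%N)
    (mu : probability (borel_matrix R n) R) (hmu : is_haar mu)
    (a b c : nat) (ha : ~~ odd a) (hb : ~~ odd b) (hc : ~~ odd c) :
  J_ hn hn mu (diag3 a b c) =
    \sum_(0 <= k < (c./2).+1)
      (-1) ^+ k * 'C(c./2, k)%:R * (k`!%:R / 2 ^+ k) *
      \sum_(0 <= r < k.+1) \sum_(0 <= s < k.+1 | (r + s == k)%N)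
        'C(2 * r, r)%:R * 'C(2 * s, s)%:R *
        ((dfact (n - 3))%:R / (dfact (c + n - 3))%:R) *
        ((dfact (a + b + c + n - 1))%:R /
         (dfact (a + b + 2 * k + n - 1))%:R) *
        ((dfact (n - 2) * dfact (a + b + 2 * r + n - 2) *
          dfact (a + b + 2 * s + n - 2))%N%:R /
         (dfact (a + b + n - 2) * dfact (a + 2 * r + n - 2) *
          dfact (b + 2 * s + n - 2))%N%:R)
  /\
  (let i1 := widen_ord hn (@Ordinal 3 0 isT) in
   let i2 := widen_ord hn (@Ordinal 3 1 isT) in
   let i3 := widen_ord hn (@Ordinal 3 2 isT) in
   \int[mu]_(u in (orthogonal_group : set 'M[R]_n))
     (u i1 i1 ^+ a * u i2 i2 ^+ b * u i3 i3 ^+ c)) =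
    (dfact (n - 1) * dfact a * dfact b * dfact c)%N%:R /
    (dfact (a + b + c + n - 1))%:R * J_ hn hn mu (diag3 a b c).
Proof.
(* Writing [n = L + 3] makes the truncated subtractions [n - 1], [n - 2], [n - 3] genuine. *)
case: n hn mu hmu => [|[|[|L]]]// hn mu hmu.
set i1 := widen_ord hn (@Ordinal 3 0 isT).
set i2 := widen_ord hn (@Ordinal 3 1 isT).
set i3 := widen_ord hn (@Ordinal 3 2 isT).
rewrite -(even_halfK ha) -(even_halfK hb) -(even_halfK hc) !doubleK.
move: a./2 b./2 c./2 => {ha hb hc} {}a {}b {}c.
have P0 : prefactor R L.+3 (diag3 a.*2 b.*2 c.*2) != 0.
  by rewrite prefactor_diag3E !mulf_neq0 ?invr_eq0 ?dfact_neq0.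
have IE := I_diag3E mu hn a.*2 b.*2 c.*2.
split; last first.
  move=> /=; rewrite /J_ !subn1 addnS /= !natrM [RHS]mulrC -prefactor_diag3E.
  by rewrite (divfK P0) IE.
rewrite /J_ IE diagonal_moment// {IE P0}.
set pre := prefactor _ _ _.
set C := (dfact c.*2)%:R * (dfact L)%:R / (dfact (c.*2 + L))%:R.
rewrite big_mkord mulr_sumr mulr_suml; apply: eq_bigr => k _.
(* The sign and the outer binomial occur on both sides, so it remains to compare the inner sums for
   fixed [k]. *)
rewrite (_ : C * _ / pre = (-1) ^+ k * 'C(c, k)%:R * (C / pre *
  \sum_(r < k.+1) 'C(k, r)%:R *
    two_row_moment mu i1 i2 i1 i2 i3 a.*2 b.*2 r.*2 (k - r).*2)); last by ring.
rewrite -[RHS]mulrA; congr (_ * _); rewrite big_mkord !mulr_sumr.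
apply: eq_bigr => r _; have rk : (r <= k)%N by rewrite -ltnS.
have sk : (k - r < k.+1)%N by rewrite ltnS leq_subr.
(* The condition [r + s == k] leaves the single index [s = k - r]. *)
rewrite big_mkord (big_pred1 (Ordinal sk)); last first.
  by move=> s /=; rewrite -val_eqE /=; apply/eqP/eqP; lia.
rewrite /= /C /pre prefactor_diag3E (two_row_momentE hmu)// !mul2n.
have -> : (L.+3 - 3)%N = L by lia.
have -> : (L.+3 - 2)%N = L.+1 by lia.
have -> : (c.*2 + L.+3 - 3)%N = (c.*2 + L)%N by lia.
have -> : (a.*2 + b.*2 + c.*2 + L.+3 - 1)%N = (a.*2 + b.*2 + c.*2 + L.+2)%N by lia.
have -> : (a.*2 + b.*2 + k.*2 + L.+3 - 1)%N =
  (a.*2 + b.*2 + r.*2 + (k - r).*2 + L.+2)%N by lia.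
have e2 m : (m + L.+3 - 2)%N = (m + L.+1)%N by lia.
rewrite !e2 !natrM.
(* The double factorials of [a], [b], [c] and [n - 1] cancel against the prefactor; the first three
   factors are isolated for [binomial_dfact]. *)
transitivity ('C(k, r)%:R * (dfact r.*2)%:R * (dfact (k - r).*2)%:R *
  ((dfact L)%:R / (dfact (c.*2 + L))%:R *
   ((dfact (a.*2 + b.*2 + c.*2 + L.+2))%:R /
    (dfact (a.*2 + b.*2 + r.*2 + (k - r).*2 + L.+2))%:R) *
   ((dfact L.+1)%:R * (dfact (a.*2 + b.*2 + r.*2 + L.+1))%:R *
    (dfact (a.*2 + b.*2 + (k - r).*2 + L.+1))%:R /
    ((dfact (a.*2 + b.*2 + L.+1))%:R * (dfact (a.*2 + r.*2 + L.+1))%:R *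
     (dfact (b.*2 + (k - r).*2 + L.+1))%:R))) : R).
  by field; solve_neq0.
by rewrite binomial_dfact//; ring.
Qed.
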